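(* Let $\boldsymbol{x}\in\mathbb{R}^n$ be a random vector with probability density function $f(\cdot;\boldsymbol\theta)$, where $\boldsymbol\theta\in\mathbb{R}^p$. Let $\hat{\boldsymbol\theta}=\hat{\boldsymbol\theta}(\boldsymbol{x})\in\mathbb{R}^p$ be an unbiased estimator of $\boldsymbol\theta$ (i.e. $\mathbb{E}\hat{\boldsymbol\theta}=\boldsymbol\theta$), and assume that the density satisfies the interchange of integral and derivative $$\frac{\partial}{\partial\boldsymbol\theta}\int_{\mathbb{R}^n}[\hat{\boldsymbol\theta}(\boldsymbol\chi)-\boldsymbol\theta]f(\boldsymbol\chi;\boldsymbol\theta)\,d\boldsymbol\chi=\int_{\mathbb{R}^n}\frac{\partial}{\partial\boldsymbol\theta}\Big([\hat{\boldsymbol\theta}(\boldsymbol\chi)-\boldsymbol\theta]f(\boldsymbol\chi;\boldsymbol\theta)\Big)\,d\boldsymbol\chi .$$ Then $\hat{\boldsymbol\theta}$ is efficient if and only if $$\mathrm{tr}\big(\mathcal{I}_{\boldsymbol\theta}^{\dagger}\big)=\mathbb{E}\big\|\hat{\boldsymbol\theta}-\boldsymbol\theta\big\|_2^2 .$$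
   Context: The Fisher information matrix is $\mathcal{I}_{\boldsymbol\theta}=\mathbb{E}\Big[\big(\frac{\partial}{\partial\boldsymbol\theta}\log f(\boldsymbol{x};\boldsymbol\theta)\big)\big(\frac{\partial}{\partial\boldsymbol\theta}\log f(\boldsymbol{x};\boldsymbol\theta)\big)^{\top}\Big]\in\mathbb{R}^{p\times p}$, and $\dagger$ denotes the (Moore--Penrose) pseudo-inverse. For a vector-valued function, $\frac{\partial}{\partial\boldsymbol\theta}$ denotes the Jacobian matrix with respect to $\boldsymbol\theta$. The covariance matrix of the unbiased estimator is $\mathrm{Var}(\hat{\boldsymbol\theta})=\mathbb{E}\big[(\hat{\boldsymbol\theta}-\boldsymbol\theta)(\hat{\boldsymbol\theta}-\boldsymbol\theta)^{\top}\big]$. Under the stated conditions, $\hat{\boldsymbol\theta}$ is called efficient if $\mathcal{I}_{\boldsymbol\theta}^{\dagger}=\mathrm{Var}(\hat{\boldsymbol\theta})$. Expectations are taken under $f(\cdot;\boldsymbol\theta)$. *)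

(* Defs.v *)
From HB Require Import structures.
From mathcomp Require Import all_boot all_order all_algebra.
From mathcomp Require Import all_classical all_reals all_analysis.
Import Order.TTheory GRing.Theory Num.Theory.
Import numFieldNormedType.Exports.

Set Implicit Arguments.
Unset Strict Implicit.
Unset Printing Implicit Defensive.

Local Open Scope classical_set_scope.
Local Open Scope ring_scope.

(* The sample space R^n is a tuple type, which carries the product Borel
   sigma-algebra; parameters, estimators and scores are column vectors, which
   carry the normed structure that derivatives need. *)
Notation Rn R n := (n.-tuple (measurableTypeR R)).

Section lebesgue_vec_cons.
Local Open Scope ereal_scope.
Context {R : realType} (n : nat).
Variable m : {sigma_finite_measure set (Rn R n) -> \bar R}.

Let consT (z : measurableTypeR R * Rn R n) : Rn R n.+1 := [tuple of z.1 :: z.2].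

Let measurable_consT : measurable_fun [set: _] consT.
Proof. exact: measurable_cons. Qed.

Definition lebesgue_vec_cons : set (Rn R n.+1) -> \bar R :=
  pushforward (@lebesgue_measure R \x m) consT.

Let cons0 : lebesgue_vec_cons set0 = 0.
Proof. by rewrite /lebesgue_vec_cons /pushforward preimage_set0 measure0. Qed.

Let cons_ge0 A : 0 <= lebesgue_vec_cons A.
Proof. exact: measure_ge0. Qed.

Let cons_sigma_additive : semi_sigma_additive lebesgue_vec_cons.
Proof.
by apply: (@measure_semi_sigma_additive _ _ _
  (measure_function_pushforward__canonical__measure_function_Measure _
    measurable_consT)).
Qed.

HB.instance Definition _ := isMeasure.Build _ _ _ lebesgue_vec_cons
  cons0 cons_ge0 cons_sigma_additive.

Let cons_sigma_finite : sigma_finite setT lebesgue_vec_cons.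
Proof.
have /sigma_finiteP[F [TF ndF Foo]] := sigma_finiteT (@lebesgue_measure R).
have /sigma_finiteP[G [TG ndG Goo]] := sigma_finiteT m.
pose unconsT (t : Rn R n.+1) : measurableTypeR R * Rn R n :=
  (thead t, [tuple of behead t]).
have consTK : cancel consT unconsT.
  by case=> x t; congr pair; exact: val_inj.
have munconsT : measurable_fun [set: _] unconsT.
  apply: measurable_fun_pair; last exact: measurable_behead.
  exact: measurable_tnth.
exists (fun k => unconsT @^-1` (F k `*` G k)).
  rewrite -preimage_bigcup (_ : \bigcup_k _ = setT) ?preimage_setT//.
  apply/seteqP; split=> // -[x t] _.
  have [[k _ Fkx] [l _ Glt]] : (\bigcup_i F i) x /\ (\bigcup_i G i) t.
    by rewrite -TF -TG.
  exists (maxn k l) => //; split.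
    by move: x Fkx; exact/subsetPset/ndF/leq_maxl.
  by move: t Glt; exact/subsetPset/ndG/leq_maxr.
move=> k; have [mFk Fk] := Foo k; have [mGk Gk] := Goo k; split.
  by rewrite -[X in measurable X]setTI; apply: munconsT => //; exact: measurableX.
rewrite /lebesgue_vec_cons /pushforward -comp_preimage.
rewrite (_ : unconsT \o consT = id); last exact/funext/consTK.
by rewrite preimage_id product_measure1E// lte_mul_pinfty// ge0_fin_numE.
Qed.

HB.instance Definition _ := Measure_isSigmaFinite.Build _ _ _
  lebesgue_vec_cons cons_sigma_finite.

End lebesgue_vec_cons.

Fixpoint lebesgue_vec {R : realType} (n : nat) :
    {sigma_finite_measure set (Rn R n) -> \bar R} :=
  if n is k.+1 then lebesgue_vec_cons (lebesgue_vec k) else \d_[tuple].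

Lemma lebesgue_vec_box (R : realType) (n : nat)
    (A : 'I_n -> set (measurableTypeR R)) : (forall i, measurable (A i)) ->
  (lebesgue_vec n [set t : Rn R n | forall i, A i (tnth t i)] =
   \prod_(i < n) lebesgue_measure (A i))%E.
Proof.
elim: n A => [|n IHn] A mA; first by rewrite big_ord0 /= diracE mem_set// => -[].
rewrite big_ord_recl -IHn; last by move=> i; exact: mA.
rewrite -product_measure1E//; last first.
  rewrite (_ : mkset _ = \bigcap_(i in [set: 'I_n])
      ((fun t : Rn R n => tnth t i) @^-1` A (lift ord0 i))).
    apply: fin_bigcap_measurable => // i _; rewrite -[X in measurable X]setTI.
    exact: measurable_tnth.
  by apply/seteqP; split=> t /= At i => [_|]; apply: At.
rewrite /= /lebesgue_vec_cons /pushforward; congr (product_measure1 _ _ _).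
apply/seteqP; split=> -[x t] /= At.
  split=> [|i]; first by have := At ord0; rewrite tnth0.
  by have := At (lift ord0 i); rewrite tnthS.
by move=> i; case: (unliftP ord0 i) => [j|] ->; rewrite ?tnthS ?tnth0; case: At.
Qed.

Section moore_penrose.
Context {R : realType}.

Definition is_moore_penrose (m n : nat) (A : 'M[R]_(m, n)) (B : 'M[R]_(n, m)) :=
  [/\ A *m B *m A = A, B *m A *m B = B,
      (A *m B)^T = A *m B & (B *m A)^T = B *m A].

Lemma is_moore_penrose_unique (m n : nat) (A : 'M[R]_(m, n)) (B C : 'M[R]_(n, m)) :
  is_moore_penrose A B -> is_moore_penrose A C -> B = C.
Proof.
move=> [B1 B2 B3 B4] [C1 C2 C3 C4].
have eAB : A *m B = A *m C.
  by rewrite -[LHS]B3 -[in LHS]C1 -(mulmxA _ A B) trmx_mul B3 C3 mulmxA B1.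
have eBA : B *m A = C *m A.
  rewrite -[LHS]B4 -[in LHS]C1 -(mulmxA A C A) mulmxA trmx_mul B4 C4.
  by rewrite -(mulmxA C) (mulmxA A) B1.
by rewrite -B2 -C2 eBA -!mulmxA eAB.
Qed.

Lemma gram_unitmx (m n : nat) (A : 'M[R]_(m, n)) :
  row_free A -> A *m A^T \in unitmx.
Proof.
move=> Afree; rewrite -row_free_unit; apply/inj_row_free => v vAA0.
apply: (row_free_inj Afree); rewrite mul0mx.
have /matrixP/(_ 0 0) : (v *m A) *m (v *m A)^T = 0.
  by rewrite trmx_mul mulmxA -(mulmxA v) vAA0 mul0mx.
rewrite mxE [RHS]mxE.
under eq_bigr do rewrite [X in _ * X]mxE -expr2.
move=> /eqP; rewrite psumr_eq0 => [|i _]; last exact: sqr_ge0.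
move=> /allP vA0; apply/rowP => j; rewrite [RHS]mxE; apply/eqP.
by have := vA0 j (mem_index_enum j); rewrite sqrf_eq0.
Qed.

Lemma is_moore_penrose_mul (m r n : nat) (C : 'M[R]_(m, r)) (F : 'M[R]_(r, n)) :
  C^T *m C \in unitmx -> F *m F^T \in unitmx ->
  is_moore_penrose (C *m F)
    (F^T *m invmx (F *m F^T) *m (invmx (C^T *m C) *m C^T)).
Proof.
move=> CC FF.
set Fi := F^T *m _; set Ci := _ *m C^T.
have FFi : F *m Fi = 1%:M by rewrite mulmxA mulmxV.
have CiC : Ci *m C = 1%:M by rewrite -mulmxA mulVmx.
have AB : C *m F *m (Fi *m Ci) = C *m Ci.
  by rewrite mulmxA -(mulmxA C) FFi mulmx1.
have BA : Fi *m Ci *m (C *m F) = Fi *m F.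
  by rewrite mulmxA -(mulmxA Fi) CiC mulmx1.
split.
- by rewrite AB mulmxA -(mulmxA C) CiC mulmx1.
- by rewrite BA mulmxA -(mulmxA Fi) FFi mulmx1.
- by rewrite AB /Ci !trmx_mul trmxK trmx_inv trmx_mul trmxK mulmxA.
- by rewrite BA /Fi !trmx_mul trmxK trmx_inv trmx_mul trmxK mulmxA.
Qed.

Lemma is_moore_penrose_ex (m n : nat) (A : 'M[R]_(m, n)) :
  exists B, is_moore_penrose A B.
Proof.
rewrite -{1}(mulmx_base A); eexists; apply: is_moore_penrose_mul.
  rewrite -{2}(trmxK (col_base A)); apply: gram_unitmx.
  by rewrite /row_free mxrank_tr; exact: col_base_full.
exact/gram_unitmx/row_base_free.
Qed.

Definition moore_penrose (m n : nat) (A : 'M[R]_(m, n)) : 'M[R]_(n, m) :=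
  xget 0 [set B | is_moore_penrose A B].

Lemma moore_penroseP (m n : nat) (A : 'M[R]_(m, n)) :
  is_moore_penrose A (moore_penrose A).
Proof. exact: xgetPex (is_moore_penrose_ex A). Qed.

End moore_penrose.

Section vector_calculus.
Context {R : realType}.

(* The library's 'J acts on row vectors, is transposed with respect to the usual
   convention and is only meaningful for Frechet-differentiable functions; the
   matrix of partial derivatives needs no more than the existence of these. *)
Definition jacobian_mx (p q : nat) (g : 'cV[R]_p -> 'cV[R]_q) (a : 'cV[R]_p) :
    'M[R]_(q, p) :=
  \matrix_(i, j) 'D_(delta_mx j 0) (fun t => g t i 0) a.

Definition gradient (p : nat) (g : 'cV[R]_p -> R) (a : 'cV[R]_p) : 'cV[R]_p :=
  \col_j 'D_(delta_mx j 0) g a.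

Definition norm2 (p : nat) (v : 'cV[R]_p) : R := Num.sqrt (\sum_i v i 0 ^+ 2).

End vector_calculus.

Section statistics.
Context {R : realType} {d : measure_display} {T : measurableType d} {n p : nat}.

(* The entries are extended reals, so that no moment is assumed to be finite. In
   particular an equality with a real matrix includes the finiteness of all the
   moments, and [efficient] fails when the variance is infinite. *)
Definition expectation_mx (P : probability T R) (q r : nat)
    (M : T -> 'M[R]_(q, r)) : 'M[\bar R]_(q, r) :=
  (\matrix_(i, j) 'E_P[fun w => M w i j])%E.

Definition has_density (P : probability T R) (X : {mfun T >-> Rn R n})
    (g : Rn R n -> R) : Prop :=
  [/\ measurable_fun [set: Rn R n] g, forall x, 0 <= g x &
      forall A, measurable A ->
        distribution P X A = (\int[lebesgue_vec n]_(x in A) (g x)%:E)%E].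

(* Where the density vanishes [ln] takes its default value, but the random vector
   avoids these points almost surely. *)
Definition score (f : Rn R n -> 'cV[R]_p -> R) (theta : 'cV[R]_p) (x : Rn R n) :
    'cV[R]_p :=
  gradient (fun t => ln (f x t)) theta.

(* The side condition under which [fisher], a real matrix, is not affected by the
   default value of [fine]. *)
Definition fisher_finite (P : probability T R) (X : T -> Rn R n)
    (f : Rn R n -> 'cV[R]_p -> R) (theta : 'cV[R]_p) : Prop :=
  forall i j, P.-integrable [set: T]
    (fun w => (score f theta (X w) i 0 * score f theta (X w) j 0)%:E).

Definition fisher (P : probability T R) (X : T -> Rn R n)
    (f : Rn R n -> 'cV[R]_p -> R) (theta : 'cV[R]_p) : 'M[R]_p :=
  map_mx fine
    (expectation_mx P (fun w => score f theta (X w) *m (score f theta (X w))^T)).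

Definition unbiased (P : probability T R) (X : T -> Rn R n)
    (that : Rn R n -> 'cV[R]_p) (theta : 'cV[R]_p) : Prop :=
  expectation_mx P (fun w => that (X w)) = map_mx EFin theta.

Definition estimator_var (P : probability T R) (X : T -> Rn R n)
    (that : Rn R n -> 'cV[R]_p) (theta : 'cV[R]_p) : 'M[\bar R]_p :=
  expectation_mx P (fun w => (that (X w) - theta) *m (that (X w) - theta)^T).

Definition efficient (P : probability T R) (X : T -> Rn R n)
    (f : Rn R n -> 'cV[R]_p -> R) (that : Rn R n -> 'cV[R]_p)
    (theta : 'cV[R]_p) : Prop :=
  map_mx EFin (moore_penrose (fisher P X f theta)) = estimator_var P X that theta.

End statistics.

(* At theta, the Jacobian of the integral is the integral of the Jacobian; the
   integrability clause is what makes the latter meaningful. *)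
Definition interchange_int_deriv {R : realType} {n p : nat}
    (f : Rn R n -> 'cV[R]_p -> R) (that : Rn R n -> 'cV[R]_p)
    (theta : 'cV[R]_p) : Prop :=
  let h (x : Rn R n) (t : 'cV[R]_p) : 'cV[R]_p := f x t *: (that x - t) in
  (forall i j, (lebesgue_vec n).-integrable [set: Rn R n]
     (fun x => (jacobian_mx (h x) theta i j)%:E)) /\
  jacobian_mx (fun t => \col_i \int[lebesgue_vec n]_x (h x t i 0)) theta =
  \matrix_(i, j) \int[lebesgue_vec n]_x (jacobian_mx (h x) theta i j).

(* Main.v *)
Require Import Defs.
From mathcomp Require Import all_boot all_order all_algebra.
From mathcomp Require Import all_classical all_reals all_analysis.
From mathcomp Require Import measurable_realfun.
From mathcomp Require Import lra.
Import Order.TTheory GRing.Theory Num.Theory.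
Import numFieldNormedType.Exports.

Set Implicit Arguments.
Unset Strict Implicit.
Unset Printing Implicit Defensive.

Local Open Scope classical_set_scope.
Local Open Scope ring_scope.

(** Write [e] for the error of the estimator and [s] for the score, both seen as
    random vectors under the parameter [theta].

    Unbiasedness says that the integral of [(thetahat x - t) * f x t] is 0 for
    every [t] near [theta], so its Jacobian at [theta] vanishes.  Exchanging
    derivative and integral and using the product rule, E[e s^T] = 1, because
    [f x theta] has integral 1 and the gradient of [f x] is [f x theta] times the
    score ([cross_moment_gradient], [score_version]).

    Let [I = E[s s^T]] be the Fisher information, [B] its pseudo-inverse, which is
    symmetric, and [y = B *m s].  By bilinearity E[e y^T] = B and
    E[y y^T] = B I B = B, so the residual [e - y] has second moment Var - B
    ([cross_moment_trace_eq]).  This matrix is a Gram matrix; if its trace is 0,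
    then each component of [e - y] has a square of integral 0, so it vanishes
    almost surely and the whole matrix is 0 ([cross_moment_trace0]).  Thus equality
    of the traces forces Var = B, and the converse is the trace of that equality.
    Equality of the traces also makes the variance finite, because it bounds the
    expected squared norm of [e].

    The analytic work lies in the passage between the sample space and the random
    vector.  Expectations of functions of [X] are integrals against the density
    ([integral_density], [integrable_density]).  Since the score is only defined
    outside a null set and where the density is positive, it is replaced by an
    almost surely equal function [sigma] that is measurable and satisfies
    [f x theta *: sigma x = gradient (f x) theta] almost everywhere, also at
    the zeros of the density, which are minima of [f x] and hence critical
    points. *)

(** * Symmetry of the pseudo-inverse *)

Section moore_penrose_symmetric.
Context {R : realType}.

Lemma is_moore_penrose_tr (m n : nat) (A : 'M[R]_(m, n)) (B : 'M[R]_(n, m)) :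
  is_moore_penrose A B -> is_moore_penrose A^T B^T.
Proof.
move=> [ABA BAB AB BA].
by split; rewrite -?trmx_mul ?mulmxA ?ABA ?BAB ?BA ?AB.
Qed.

Lemma tr_moore_penrose (p : nat) (A : 'M[R]_p) :
  A^T = A -> (moore_penrose A)^T = moore_penrose A.
Proof.
move=> At; apply: (@is_moore_penrose_unique _ _ _ A); last exact: moore_penroseP.
by rewrite -{1}At; exact/is_moore_penrose_tr/moore_penroseP.
Qed.

End moore_penrose_symmetric.

(** * Cross moments of random vectors *)

Section cross_moment.
Context {R : realType} {d : measure_display} {T : measurableType d}.
Variable mu : {measure set T -> \bar R}.

Lemma ae_eq_integrable (f g : T -> R) :
    measurable_fun [set: T] f -> measurable_fun [set: T] g ->
    {ae mu, forall w, f w = g w} ->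
  mu.-integrable [set: T] (EFin \o f) -> mu.-integrable [set: T] (EFin \o g).
Proof.
move=> mf mg fg /integrableP[_ foo]; apply/integrableP; split.
  exact/measurable_EFinP.
rewrite (ae_eq_integral (fun w => `|(f w)%:E|%E))//.
- by apply: measurableT_comp => //; exact/measurable_EFinP.
- by apply: measurableT_comp => //; exact/measurable_EFinP.
by apply: filterS fg => w /= -> _.
Qed.

(** Integrability of the entries is part of the definition, so that the cross moment
    is bilinear in [a] and [b]. *)
Definition cross_moment (q r : nat) (a : T -> 'cV[R]_q) (b : T -> 'cV[R]_r)
    (G : 'M[R]_(q, r)) : Prop :=
  forall i j, mu.-integrable [set: T] (fun w => (a w i 0 * b w j 0)%:E) /\
    (\int[mu]_w (a w i 0 * b w j 0)%:E)%E = (G i j)%:E.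

Lemma cross_moment_tr (q r : nat) (a : T -> 'cV[R]_q) (b : T -> 'cV[R]_r) G :
  cross_moment a b G -> cross_moment b a G^T.
Proof.
move=> abG i j; have [abi abI] := abG j i; rewrite mxE -abI; split.
  by apply: eq_integrable abi => // w _; rewrite mulrC.
by apply: eq_integral => w _; rewrite mulrC.
Qed.

Lemma cross_momentB (q r : nat) (a a' : T -> 'cV[R]_q) (b : T -> 'cV[R]_r) G G' :
  cross_moment a b G -> cross_moment a' b G' ->
  cross_moment (fun w => a w - a' w) b (G - G').
Proof.
move=> abG abG' i j; have [abi abI] := abG i j; have [abi' abI'] := abG' i j.
have E w : (((a w - a' w) i 0 * b w j 0)%:E =
    (a w i 0 * b w j 0)%:E - (a' w i 0 * b w j 0)%:E)%E.
  by rewrite -EFinB !mxE mulrBl.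
split.
  by apply: eq_integrable (integrableB measurableT abi abi') => // w _; rewrite E.
under eq_integral do rewrite E.
by rewrite integralB// !mxE EFinB; congr (_ - _)%E.
Qed.

Lemma cross_moment_mul (p q r : nat) (A : 'M[R]_(p, q)) (a : T -> 'cV[R]_q)
    (b : T -> 'cV[R]_r) G :
  cross_moment a b G -> cross_moment (fun w => A *m a w) b (A *m G).
Proof.
move=> abG i j.
have E w : (((A *m a w) i 0 * b w j 0)%:E =
    \sum_(k < q) (A i k)%:E * (a w k 0 * b w j 0)%:E)%E.
  rewrite mxE mulr_suml -sumEFin; apply: eq_bigr => k _.
  by rewrite -EFinM mulrA.
have I k : mu.-integrable [set: T]
    (fun w => (A i k)%:E * (a w k 0 * b w j 0)%:E)%E.
  by apply: integrableZl => //; case: (abG k j).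
split.
  apply: (eq_integrable measurableT _ _ (fun w _ => esym (E w))).
  by apply: integrable_sum => // k _; exact: I.
under eq_integral do rewrite E.
rewrite integral_sum// mxE -sumEFin; apply: eq_bigr => k _.
by have [abi abI] := abG k j; rewrite integralZl// abI.
Qed.

Lemma cross_moment_sub (q : nat) (a b : T -> 'cV[R]_q) V C W :
    cross_moment a a V -> cross_moment a b C -> cross_moment b b W ->
  cross_moment (fun w => a w - b w) (fun w => a w - b w) (V - C - C^T + W).
Proof.
move=> aV abC bW.
have := cross_momentB (cross_moment_tr (cross_momentB aV (cross_moment_tr abC)))
  (cross_moment_tr (cross_momentB abC bW)).
move=> /cross_moment_tr; congr cross_moment.
by rewrite linearB/= !trmxK opprB addrA addrAC (addrAC V).
Qed.


Lemma cross_moment_ae_eq (q r : nat) (a a' : T -> 'cV[R]_q) (b b' : T -> 'cV[R]_r)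
    G :
    (forall i j, measurable_fun [set: T] (fun w => a' w i 0 * b' w j 0)) ->
    {ae mu, forall w, a w = a' w} -> {ae mu, forall w, b w = b' w} ->
  cross_moment a b G -> cross_moment a' b' G.
Proof.
move=> mab' aa' bb' abG i j; have [abi <-] := abG i j.
have mab : measurable_fun [set: T] (fun w => a w i 0 * b w j 0).
  by apply/measurable_EFinP; exact: measurable_int abi.
have E : {ae mu, forall w, a w i 0 * b w j 0 = a' w i 0 * b' w j 0}.
  by apply: filterS2 aa' bb' => w -> ->.
split; first exact: ae_eq_integrable E abi.
apply: ae_eq_integral => //; [exact/measurable_EFinP..|].
by apply: filterS E => w /= ->.
Qed.

Lemma sqr_integral_eq0 (f : T -> R) : measurable_fun [set: T] f ->
  (\int[mu]_w (f w * f w)%:E)%E = 0%E -> {ae mu, forall w, f w = 0}.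
Proof.
move=> mf I0.
have /ae_eq_integral_abs : measurable_fun [set: T] (fun w => (f w * f w)%:E).
  by apply/measurable_EFinP; exact: measurable_funM.
move=> /(_ mu measurableT)[+ _].
under eq_integral do rewrite gee0_abs ?lee_fin -?expr2 ?sqr_ge0//.
move=> /(_ I0); apply: filterS => w /(_ I)/= [] /eqP.
by rewrite -expr2 sqrf_eq0 => /eqP.
Qed.

(** The diagonal entries of a Gram matrix are nonnegative, so all of them are 0,
    and a function whose square has integral 0 vanishes almost everywhere. *)
Lemma cross_moment_trace0 (q : nat) (u : T -> 'cV[R]_q) G :
    (forall i, measurable_fun [set: T] (fun w => u w i 0)) ->
  cross_moment u u G -> \tr G = 0 -> G = 0.
Proof.
move=> mu_ uG tr0.
have G0 i : 0 <= G i i.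
  rewrite -lee_fin; have [_ <-] := uG i i.
  by apply: integral_ge0 => w _; rewrite lee_fin -expr2 sqr_ge0.
have Gii i : G i i = 0 by exact: psumr_eq0P tr0 _ isT.
have u0 i : {ae mu, forall w, u w i 0 = 0}.
  by apply: sqr_integral_eq0 => //; have [_ ->] := uG i i; rewrite Gii.
apply/matrixP => i j; apply/EFin_inj; have [ui <-] := uG i j.
rewrite mxE (ae_eq_integral (cst 0%E)) ?integral0//.
  exact: measurable_int ui.
by apply: filterS (u0 i) => w /= ->; rewrite mul0r.
Qed.

(** Each product [a_i * a_j] is dominated by the squared norm. *)
Lemma cross_moment_ex (q : nat) (a : T -> 'cV[R]_q) :
    (forall i, measurable_fun [set: T] (fun w => a w i 0)) ->
    (\int[mu]_w (\sum_i a w i 0 ^+ 2)%:E < +oo)%E ->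
  exists V, cross_moment a a V.
Proof.
move=> ma aoo.
have ai i j : mu.-integrable [set: T] (fun w => (a w i 0 * a w j 0)%:E).
  apply: (le_integrable measurableT (g := fun w => (\sum_k a w k 0 ^+ 2)%:E)) => //.
  - by apply/measurable_EFinP; exact: measurable_funM.
  - move=> w _; rewrite !abse_EFin lee_fin [leRHS]ger0_norm; last first.
      by apply: sumr_ge0 => k _; exact: sqr_ge0.
    have L k : a w k 0 ^+ 2 <= \sum_k a w k 0 ^+ 2.
      by rewrite (bigD1 k)//= lerDl sumr_ge0// => *; exact: sqr_ge0.
    (* |xy| <= (x^2 + y^2) / 2, from the square of |x| - |y|. *)
    rewrite -[leLHS](@mulfK _ 2)// ler_pdivrMr// normrM.
    have := sqr_ge0 (`|a w i 0| - `|a w j 0|).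
    rewrite sqrrB !real_normK ?num_real//.
    by have := L i; have := L j; lra.
  apply/integrableP; split.
    apply/measurable_EFinP; apply: measurable_sum => k.
    exact: measurable_funX.
  rewrite (eq_integral (fun w => (\sum_i a w i 0 ^+ 2)%:E))// => w _.
  by rewrite gee0_abs// lee_fin sumr_ge0// => k _; exact: sqr_ge0.
exists (\matrix_(i, j) fine (\int[mu]_w (a w i 0 * a w j 0)%:E)%E) => i j.
by split=> //; rewrite mxE fineK// integrable_fin_num.
Qed.

Lemma cross_moment_trace (q : nat) (a : T -> 'cV[R]_q) V :
    (forall i, measurable_fun [set: T] (fun w => a w i 0)) ->
  cross_moment a a V ->
  (\int[mu]_w (\sum_i a w i 0 ^+ 2)%:E)%E = (\tr V)%:E.
Proof.
move=> ma aV; under eq_integral do rewrite -sumEFin.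
rewrite ge0_integral_sum//.
- rewrite /mxtrace -sumEFin; apply: eq_bigr => i _.
  by have [_ <-] := aV i i.
- by move=> i; apply/measurable_EFinP; exact: measurable_funX.
- by move=> i w _; rewrite lee_fin sqr_ge0.
Qed.

(** With [y := B *m s], the cross moment of [e] and [y] and the second moment of
    [y] are both [B], so the residual [e - y] has second moment [V - B], where [V]
    is that of [e].  Equality of the traces makes this Gram matrix trace-free,
    hence zero. *)
Lemma cross_moment_trace_eq (q : nat) (e s : T -> 'cV[R]_q) (M B : 'M[R]_q) :
    (forall i, measurable_fun [set: T] (fun w => e w i 0)) ->
    (forall i, measurable_fun [set: T] (fun w => s w i 0)) ->
    cross_moment s s M -> cross_moment e s 1%:M ->
    B^T = B -> B *m M *m B = B ->
  cross_moment e e B <->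
  (\int[mu]_w (\sum_i e w i 0 ^+ 2)%:E)%E = (\tr B)%:E.
Proof.
move=> me ms sM es Bt BMB; split => [|trB]; first exact: cross_moment_trace.
have [|V eV] := cross_moment_ex me; first by rewrite trB ltry.
have trV : \tr V = \tr B.
  by apply/EFin_inj; rewrite -trB (cross_moment_trace me eV).
have ey : cross_moment e (fun w => B *m s w) B.
  have := cross_moment_tr (cross_moment_mul B (cross_moment_tr es)).
  by rewrite trmx1 mulmx1 Bt.
have yy : cross_moment (fun w => B *m s w) (fun w => B *m s w) B.
  have := cross_moment_tr (cross_moment_mul B (cross_moment_tr
    (cross_moment_mul B sM))).
  by rewrite trmx_mul trmxK Bt BMB.
have muy i : measurable_fun [set: T] (fun w => (e w - B *m s w) i 0).
  rewrite (_ : (fun w => _) = (fun w => e w i 0 - \sum_k B i k * s w k 0)).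
    apply: measurable_funB => //; apply: measurable_sum => k.
    exact: measurable_funM.
  by apply/funext => w; rewrite !mxE.
have := cross_moment_sub eV ey yy; rewrite Bt subrK => eyVB.
have /eqP := cross_moment_trace0 muy eyVB (etrans (linearB _ _ _) (etrans
  (congr1 (fun x => x - \tr B) trV) (subrr _))).
by rewrite subr_eq0 => /eqP <-.
Qed.

End cross_moment.

(** * Directional derivatives *)

Section directional_derivative.
Context {R : realType} {V : normedModType R}.
Implicit Types (F : V -> R) (a v : V).

Lemma derive_quotient_line F a v :
  (fun h : R => h^-1 *: ((F \o shift a) (h *: v) - F a)) =
  (fun h : R => h^-1 *: (((fun k : R => F (k *: v + a)) \o shift 0) (h *: 1)
                          - F (0 *: v + a))).
Proof.
by apply/funext => h /=; rewrite addr0 scale0r add0r [h *: 1]mulr1.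
Qed.

(** Both sides are limits of the same difference quotient; the rules for functions
    of one real variable, such as the chain rule, thus apply to directional
    derivatives. *)
Lemma is_derive_line F a v (l : R) :
  is_derive a v F l <-> is_derive (0 : R) 1 (fun h : R => F (h *: v + a)) l.
Proof.
have dE : derivable F a v = derivable (fun h : R => F (h *: v + a)) 0 1.
  by rewrite /derivable derive_quotient_line.
have DE : 'D_v F a = 'D_1 (fun h : R => F (h *: v + a)) 0.
  by rewrite /derive derive_quotient_line.
by split=> -[+ <-]; [rewrite dE DE|rewrite -dE -DE] => dF; exact: DeriveDef.
Qed.

Lemma derive_ln F a v : 0 < F a -> derivable F a v ->
  'D_v (fun t => ln (F t)) a = 'D_v F a / F a.
Proof.
move=> Fa0 /derivableP/is_derive_line dF.
have [|_ ->//] := (is_derive_line (fun t => ln (F t)) a v ('D_v F a / F a)).2.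
rewrite mulrC.
apply: (@is_derive1_comp _ (@ln R) (fun h : R => F (h *: v + a))).
by rewrite scale0r add0r; exact: is_derive1_ln.
Qed.

Lemma cvg_line a v : h *: v + a @[h --> (0 : R)] --> a.
Proof.
rewrite -[X in _ --> X]add0r -[X in X + a](scale0r v).
apply: cvgD; last exact: cvg_cst.
by apply: cvgZr_tmp; exact: cvg_id.
Qed.

(** Fermat's rule: the difference quotient is nonpositive on the left of 0 and
    nonnegative on the right. *)
Lemma derive_near_min F a v : (\near a, 0 <= F a) -> F a = 0 ->
  derivable F a v -> 'D_v F a = 0.
Proof.
move=> F_ge0 Fa0 dF.
have q : h^-1 *: (F (h *: v + a) - F a) @[h --> (0 : R)^'] --> 'D_v F a by [].
have F_ge0l : \forall h \near (0 : R), 0 <= F (h *: v + a).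
  exact: (@cvg_line a v _ F_ge0).
apply/eqP; rewrite eq_le; apply/andP; split.
- have ql := cvg_dnbhs_at_left q; rewrite -(cvg_lim _ ql)//.
  apply: limr_le; first by apply/cvg_ex; exists ('D_v F a).
  near=> h; rewrite Fa0 subr0 mulr_le0_ge0//; last first.
    by near: h; exact: cvg_within F_ge0l.
  by rewrite invr_le0; near: h; exact: nbhs_left_le.
- have qr := cvg_dnbhs_at_right q; rewrite -(cvg_lim _ qr)//.
  apply: limr_ge; first by apply/cvg_ex; exists ('D_v F a).
  near=> h; rewrite Fa0 subr0 mulr_ge0//; last first.
    by near: h; exact: cvg_within F_ge0l.
  by rewrite invr_ge0; near: h; exact: nbhs_right_ge.
Unshelve. all: by end_near. Qed.

Context {d : measure_display} {T : measurableType d}.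

(** The derivative is the pointwise limit of difference quotients along a sequence
    of steps. *)
Lemma measurable_derive (D : set T) (F : T -> V -> R) a v :
    (\near a, measurable_fun D (F ^~ a)) ->
    (forall x, D x -> derivable (F x) a v) ->
  measurable_fun D (fun x => 'D_v (F x) a).
Proof.
move=> mF dF.
have /nbhs_ballP[r /= r0 rF] : \forall h \near (0 : R),
  measurable_fun D (fun x => F x (h *: v + a)).
  exact: (@cvg_line a v _ mF).
(* Steps that stay in the ball where the translates of [F] are measurable. *)
pose u k : R := r / 2 * k.+1%:R^-1.
have u0 k : 0 < u k by rewrite /u mulr_gt0// ?divr_gt0// invr_gt0.
have uF k : measurable_fun D (fun x => F x (u k *: v + a)).
  apply: rF; rewrite /ball/= sub0r normrN gtr0_norm// /u.
  rewrite -mulrA gtr_pMr//.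
  by rewrite -invfM -natrM mulnC muln2 invf_lt1 ?ltr1n ?ltr0n ?doubleS.
have ul : u k @[k --> \oo] --> (0 : R).
  rewrite -(mulr0 (r / 2)); apply: cvgM; first exact: cvg_cst.
  exact: cvg_harmonic.
apply: (@measurable_fun_cvg _ _ _ _
  (fun k x => (u k)^-1 * (F x (u k *: v + a) - F x a))) => [k|x Dx].
  apply: measurable_funM => //; apply: measurable_funB => //.
  exact: nbhs_singleton mF.
have /cvg_dnbhs_at_right/cvg_at_rightP : h^-1 *: (F x (h *: v + a) - F x a)
  @[h --> (0 : R)^'] --> 'D_v (F x) a by exact: dF.
exact.
Qed.

End directional_derivative.

(** * Integration against a density *)

Section density.
Context {R : realType} {n : nat} {d : measure_display} {T : measurableType d}.
Variables (P : probability T R) (X : {mfun T >-> Rn R n}) (g : Rn R n -> R).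
Hypothesis Pg : has_density P X g.
Local Open Scope ereal_scope.

Let mg : measurable_fun [set: Rn R n] (EFin \o g).
Proof. by case: Pg => mg _ _; exact/measurable_EFinP. Qed.

Let g0 x : (0 <= g x)%R. Proof. by case: Pg. Qed.

Lemma density_integral1 : \int[lebesgue_vec n]_x (g x)%:E = 1.
Proof. by case: Pg => _ _ <-//; rewrite probability_setT. Qed.

Lemma density_integrable : (lebesgue_vec n).-integrable [set: Rn R n] (EFin \o g).
Proof.
apply/integrableP; split => //.
under eq_integral do rewrite gee0_abs ?lee_fin//.
by rewrite density_integral1 ltry.
Qed.

(** By uniqueness of the Radon-Nikodym derivative, [g] is almost everywhere that of
    the distribution of [X], for which the change of variables is known. *)
Lemma ge0_integral_density (phi : Rn R n -> \bar R) :
    measurable_fun [set: Rn R n] phi -> (forall x, 0 <= phi x) ->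
  \int[P]_w phi (X w) = \int[lebesgue_vec n]_x (phi x * (g x)%:E).
Proof.
move=> mphi phi0; pose nu : probability _ _ := distribution P X.
have nuE A : measurable A -> nu A = \int[lebesgue_vec n]_(x in A) (g x)%:E.
  by case: Pg => _ _; exact.
have nul : nu `<< lebesgue_vec n.
  apply/null_content_dominatesP => A mA A0; rewrite nuE//.
  by apply: null_set_integral => //; exact: measurable_funTS.
rewrite -(ge0_integral_distribution (X : {RV P >-> Rn R n}) mphi phi0).
rewrite -(Radon_Nikodym_SigmaFinite.change_of_variables nul)//.
have fi := Radon_Nikodym_SigmaFinite.f_integrable nul.
have fg : ae_eq (lebesgue_vec n) setT
    (Radon_Nikodym_SigmaFinite.f nu (lebesgue_vec n)) (EFin \o g).
  apply: integral_ae_eq => // A _ mA.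
  by rewrite -(Radon_Nikodym_SigmaFinite.f_integral nul mA); exact: nuE.
apply: ae_eq_integral => //; last exact: ae_eqe_mul2l.
- by apply: emeasurable_funM => //; exact: measurable_int fi.
- exact: emeasurable_funM.
Qed.

(** Multiplication by [g >= 0] commutes with taking positive and negative parts, so
    the two integrals agree even when infinite. *)
Lemma integral_density (phi : Rn R n -> R) : measurable_fun [set: Rn R n] phi ->
  \int[P]_w (phi (X w))%:E = \int[lebesgue_vec n]_x (phi x * g x)%:E.
Proof.
move=> mphi; have mEphi : measurable_fun [set: Rn R n] (EFin \o phi).
  exact/measurable_EFinP.
rewrite integralE [RHS]integralE; congr (_ - _).
- rewrite (eq_integral (fun w => ((EFin \o phi)^\+ (X w)))) => [|w _]; last first.
    by rewrite !funeposE.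
  rewrite ge0_integral_density; [|exact: measurable_funepos|by []].
  apply: eq_integral => x _; rewrite !funeposE /=.
  by rewrite maxe_pMl// ?lee_fin// mul0e.
- rewrite (eq_integral (fun w => ((EFin \o phi)^\- (X w)))) => [|w _]; last first.
    by rewrite !funenegE.
  rewrite ge0_integral_density; [|exact: measurable_funeneg|by []].
  apply: eq_integral => x _; rewrite !funenegE /=.
  by rewrite maxe_pMl// ?lee_fin// mul0e -EFinM mulNr.
Qed.

Lemma integrable_density (phi : Rn R n -> R) : measurable_fun [set: Rn R n] phi ->
  (lebesgue_vec n).-integrable [set: Rn R n] (fun x => (phi x * g x)%:E) ->
  P.-integrable [set: T] (fun w => (phi (X w))%:E).
Proof.
move=> mphi /integrableP[_ foo]; apply/integrableP; split.
  by apply/measurable_EFinP; exact: measurableT_comp.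
have := @ge0_integral_density (fun x => `|(phi x)%:E|) _ _.
move=> -> //; last by apply: measurableT_comp => //; exact/measurable_EFinP.
rewrite (eq_integral (fun x => `|(phi x * g x)%:E|))// => x _.
by rewrite EFinM abseM [X in _ = _ * X]gee0_abs ?lee_fin.
Qed.

(** [X] avoids the zeros of its density almost surely. *)
Lemma density_ae (Q : Rn R n -> Prop) :
    {ae lebesgue_vec n, forall x, (0 < g x)%R -> Q x} ->
  {ae P, forall w, Q (X w)}.
Proof.
move=> [N [mN N0 QN]].
pose A := N `|` g @^-1` [set 0%R].
have mg0 : measurable (g @^-1` [set 0%R]).
  by rewrite -[X in measurable X]setTI; case: Pg => mg' _ _; exact: mg'.
have mA : measurable A by exact: measurableU.
exists (X @^-1` A); split.
- by rewrite -[X in measurable X]setTI; exact: measurable_funP.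
- case: Pg => _ _ /(_ _ mA); rewrite /distribution/= /pushforward => ->.
  rewrite (ae_eq_integral (cst 0)) ?integral0//.
    exact: measurable_funTS.
  exists N; split => // x /= /not_implyP[[//|/= ->] gx]; exact: absurd.
- move=> w /= nQ; have [/eqP gXw|] := boolP (g (X w) == 0%R); [by right|].
  move=> gXw; left; apply: QN => /= /(_ _)/nQ; apply.
  by rewrite lt0r gXw g0.
Qed.

End density.

(** * The score of a regular family *)

Section estimator_derivatives.
Context {R : realType} {p : nat}.

Lemma is_derive_coord (a v : 'cV[R]_p) i :
  is_derive a v (fun t : 'cV[R]_p => t i 0) (v i 0).
Proof.
apply/is_derive_line.
rewrite (_ : (fun h : R => _) = v i 0 \*: id + cst (a i 0)).
  by apply: is_derive_eq; rewrite addr0 [_ *: _]mulr1.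
by apply/funext => h; rewrite !mxE /= mulrC.
Qed.

Lemma jacobian_mx_scale_sub (F : 'cV[R]_p -> R) (c a : 'cV[R]_p) i j :
    derivable F a (delta_mx j 0) ->
  jacobian_mx (fun t => F t *: (c - t)) a i j =
    gradient F a j 0 * (c - a) i 0 - F a * (i == j)%:R.
Proof.
move=> /derivableP dF; rewrite !mxE.
rewrite (_ : (fun t => _) = F * (cst (c i 0) - (fun t : 'cV[R]_p => t i 0))).
  have dc := is_derive_coord a (delta_mx j 0) i.
  rewrite derive_val !mxE eqxx andbT sub0r.
  rewrite [F a *: _]mulrN [_ *: 'D__ _ _]mulrC.
  exact: addrC.
by apply/funext => t; rewrite !mxE.
Qed.

End estimator_derivatives.

Section regular_family.
Context {R : realType} {n p : nat} {d : measure_display} {T : measurableType d}.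
Variables (Theta : set 'cV[R]_p) (theta : 'cV[R]_p).
Variables (P : 'cV[R]_p -> probability T R) (X : {mfun T >-> Rn R n}).
Variables (f : Rn R n -> 'cV[R]_p -> R) (thetahat : Rn R n -> 'cV[R]_p).

Hypothesis openTheta : open Theta.
Hypothesis Theta_theta : Theta theta.
Hypothesis density : forall t, Theta t -> has_density (P t) X (fun x => f x t).

Let near_Theta : \near theta, Theta theta.
Proof. exact: open_nbhs_nbhs. Qed.

(** Outside a measurable null set [N] the partial derivatives exist and are
    measurable; on [N] the gradient may be an arbitrary default value, so it is
    replaced by 0.  At a zero of [f ^~ theta] the function [f x] is minimal, because
    it is nonnegative near [theta]. *)
Lemma measurable_gradient_version :
    {ae lebesgue_vec n, forall x, forall j, derivable (f x) theta (delta_mx j 0)} ->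
  exists g : Rn R n -> 'cV[R]_p,
    [/\ forall j, measurable_fun [set: Rn R n] (fun x => g x j 0),
        {ae lebesgue_vec n, forall x, g x = gradient (f x) theta} &
        forall x, f x theta = 0 -> g x = 0].
Proof.
move=> [N [mN N0 dN]].
have df x : (~` N) x -> forall j, derivable (f x) theta (delta_mx j 0).
  by move=> Nx; apply: contrapT => ndf; apply: Nx; exact: dN.
exists (fun x => \col_j ((fun x => gradient (f x) theta j 0) \_ (~` N)) x).
split=> [j||x fx0].
- under eq_fun do rewrite mxE.
  apply/(measurable_restrict _ _ _).1 => //; first exact: measurableC.
  under eq_fun do rewrite mxE.
  apply: measurable_derive => [|x [_ /df]//].
  apply: filterS near_Theta => t /density[mft _ _]; exact: measurable_funTS.
- exists N; split=> // x /= gx; apply: contrapT => Nx; apply: gx.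
  by apply/colP => j; rewrite mxE patchE mem_set.
- apply/colP => j; rewrite !mxE patchE; case: ifPn => // /set_mem /df dfx.
  rewrite mxE; apply: derive_near_min => //.
  by apply: filterS near_Theta => t /density[_ ft0 _].
Qed.

Hypothesis mthetahat : forall i, measurable_fun [set: Rn R n]
  (fun x => thetahat x i 0).

Lemma integral_centered t i : Theta t -> unbiased (P t) X thetahat t ->
  (\int[lebesgue_vec n]_x ((thetahat x - t) i 0 * f x t)%:E = 0)%E.
Proof.
move=> Tt /matrixP/(_ i 0); rewrite !mxE unlock => Et.
have mt : measurable_fun [set: T] (fun w => thetahat (X w) i 0).
  by apply: (measurableT_comp (mthetahat i)); exact: measurable_funP.
have it : (P t).-integrable [set: T] (fun w => (thetahat (X w) i 0)%:E).
  apply/integrableP; split; first exact/measurable_EFinP.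
  by rewrite integral_fin_num_abs// Et.
have -> : (fun x => ((thetahat x - t) i 0 * f x t)%:E) =
    (fun x => ((thetahat x i 0 - t i 0) * f x t)%:E).
  by apply/funext => x; rewrite !mxE.
rewrite -(integral_density (density Tt) (phi := fun x => thetahat x i 0 - t i 0)).
  rewrite integralB_EFin//; last exact: finite_measure_integrable_cst.
  by rewrite Et integral_cst// [X in (_ * X)%E](probability_setT (P t)) mule1 subee.
exact: measurable_funB.
Qed.

Hypothesis unbiased_near : forall t, Theta t -> unbiased (P t) X thetahat t.

Lemma jacobian_centered :
  jacobian_mx (fun t => \col_i \int[lebesgue_vec n]_x
    ((f x t *: (thetahat x - t)) i 0)) theta = 0 :> 'M[R]_p.
Proof.
apply/matrixP => i j; rewrite !mxE -[RHS](derive_cst 0 theta (delta_mx j 0)).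
apply: near_eq_derive; apply: filterS near_Theta => t Tt; rewrite mxE.
rewrite /Rintegral (eq_integral (fun x => ((thetahat x - t) i 0 * f x t)%:E)).
  by rewrite integral_centered//; exact: unbiased_near.
by move=> x _; rewrite mxE mulrC.
Qed.

Hypothesis interchange : interchange_int_deriv f thetahat theta.

(** The Jacobian of [f x t *: (thetahat x - t)] at [theta] is
    [e *m g^T - f x theta *: 1] almost everywhere, with [e = thetahat x - theta]. Its
    integral is the Jacobian of a function that vanishes near [theta], and
    [f ^~ theta] has integral 1. *)
Lemma cross_moment_gradient (g : Rn R n -> 'cV[R]_p) :
    (forall j, measurable_fun [set: Rn R n] (fun x => g x j 0)) ->
    {ae lebesgue_vec n, forall x, forall j, derivable (f x) theta (delta_mx j 0)} ->
    {ae lebesgue_vec n, forall x, g x = gradient (f x) theta} ->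
  cross_moment (lebesgue_vec n) (fun x => thetahat x - theta) g 1%:M.
Proof.
move=> mg df gE i j; rewrite mxE.
have [inth] := interchange; rewrite jacobian_centered => /matrixP/(_ i j).
rewrite !mxE; have := inth i j; set J := fun x => jacobian_mx _ _ _ _ => iJ IJ.
have IJ0 : (\int[lebesgue_vec n]_x (J x)%:E = 0)%E.
  by rewrite -[LHS]fineK ?integrable_fin_num// -[fine _]IJ.
have me : measurable_fun [set: Rn R n] (fun x => (thetahat x - theta) i 0).
  rewrite (_ : (fun x => _) = (fun x => thetahat x i 0 - theta i 0)).
    exact: measurable_funB.
  by apply/funext => x; rewrite !mxE.
have [mf _ _] := density Theta_theta.
have if_ := density_integrable (density Theta_theta).
pose K x := (thetahat x - theta) i 0 * g x j 0 - (i == j)%:R * f x theta.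
have mK : measurable_fun [set: Rn R n] K.
  by apply: measurable_funB; exact: measurable_funM.
have mJ : measurable_fun [set: Rn R n] J.
  by apply/measurable_EFinP; exact: measurable_int (inth i j).
have JK : {ae lebesgue_vec n, forall x, J x = K x}.
  apply: filterS2 df gE => x dfx gx.
  by rewrite /J jacobian_mx_scale_sub// /K gx mulrC [f x theta * _]mulrC.
have iK : (lebesgue_vec n).-integrable [set: Rn R n] (EFin \o K).
  exact: (ae_eq_integrable mJ mK JK (inth i j)).
have IK : (\int[lebesgue_vec n]_x (K x)%:E = 0)%E.
  rewrite -IJ0; apply: ae_eq_integral => //; [exact/measurable_EFinP..|].
  by apply: filterS JK => x /= ->.
have ifd : (lebesgue_vec n).-integrable [set: Rn R n]
    (fun x => (i == j)%:R%:E * (f x theta)%:E)%E.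
  exact: integrableZl.
have E x : (((thetahat x - theta) i 0 * g x j 0)%:E =
    (K x)%:E + (i == j)%:R%:E * (f x theta)%:E)%E.
  by rewrite -EFinM -EFinD subrK.
split.
  apply: (eq_integrable measurableT _ _ (fun x _ => esym (E x))).
  exact: integrableD.
under eq_integral do rewrite E.
rewrite integralD// IK add0e integralZl//.
by rewrite (density_integral1 (density Theta_theta)) mule1.
Qed.

(** [sigma] is the gradient of [f x] divided by [f x theta].  As the gradient
    vanishes at the zeros of [f ^~ theta], [f x theta *: sigma x] is the gradient
    almost everywhere, which turns the Lebesgue integral of [e *m g^T] into an
    expectation. *)
Lemma score_version :
    {ae lebesgue_vec n, forall x, forall j, derivable (f x) theta (delta_mx j 0)} ->
  exists sigma : Rn R n -> 'cV[R]_p,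
    [/\ forall j, measurable_fun [set: Rn R n] (fun x => sigma x j 0),
        {ae P theta, forall w, score f theta (X w) = sigma (X w)} &
        cross_moment (P theta) (fun w => thetahat (X w) - theta)
          (fun w => sigma (X w)) 1%:M].
Proof.
move=> df; have [g [mg gE g0]] := measurable_gradient_version df.
have f_ge0 x : 0 <= f x theta by have [] := density Theta_theta.
pose sigma x := (f x theta)^-1 *: g x.
have msigma j : measurable_fun [set: Rn R n] (fun x => sigma x j 0).
  (* Inversion is measurable as a power, on nonnegative reals. *)
  rewrite (_ : (fun x => _) = (fun x => f x theta `^ (-1) * g x j 0)).
    apply: measurable_funM => //.
    apply: (measurableT_comp (measurable_powR (-1))).
    by have [] := density Theta_theta.
  by apply/funext => x; rewrite mxE powR_inv1.
have sigmaf x : f x theta *: sigma x = g x.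
  have [fx0|fx0] := eqVneq (f x theta) 0; first by rewrite fx0 scale0r g0.
  by rewrite /sigma scalerA mulfV// scale1r.
exists sigma; split=> // [|i j].
  apply: (density_ae (density Theta_theta)
    (Q := fun x => score f theta x = sigma x)).
  apply: filterS2 df gE => x dfx gx fx0; apply/colP => j.
  rewrite !mxE derive_ln// gx !mxE; exact: mulrC.
have me : measurable_fun [set: Rn R n] (fun x => (thetahat x - theta) i 0).
  rewrite (_ : (fun x => _) = (fun x => thetahat x i 0 - theta i 0)).
    exact: measurable_funB.
  by apply/funext => x; rewrite !mxE.
have mes : measurable_fun [set: Rn R n]
  (fun x => (thetahat x - theta) i 0 * sigma x j 0) by exact: measurable_funM.
have esf x : (thetahat x - theta) i 0 * sigma x j 0 * f x theta =
    (thetahat x - theta) i 0 * g x j 0.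
  by rewrite -mulrA; congr (_ * _); rewrite -sigmaf [RHS]mxE mulrC.
have [egi egI] := cross_moment_gradient mg df gE i j.
split.
  apply: (integrable_density (density Theta_theta) mes).
  by under eq_fun do rewrite esf.
rewrite (integral_density (density Theta_theta) mes).
by under eq_integral do rewrite esf.
Qed.

End regular_family.

(** * Expectation matrices as cross moments *)

Section second_moments.
Context {R : realType} {d : measure_display} {T : measurableType d} {p : nat}.
Variable P : probability T R.
Implicit Types (a : T -> 'cV[R]_p).

Lemma expectation_mx_outer a i j :
  expectation_mx P (fun w => a w *m (a w)^T) i j =
  (\int[P]_w (a w i 0 * a w j 0)%:E)%E.
Proof.
rewrite mxE unlock; apply: eq_integral => w _.
by rewrite mxE big_ord1 mxE.
Qed.

Lemma tr_fine_expectation_mx_outer a :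
  (map_mx fine (expectation_mx P (fun w => a w *m (a w)^T)))^T =
  map_mx fine (expectation_mx P (fun w => a w *m (a w)^T)).
Proof.
apply/matrixP => i j; rewrite [LHS]mxE [LHS]mxE [RHS]mxE; congr fine.
by rewrite !expectation_mx_outer; apply: eq_integral => w _; rewrite mulrC.
Qed.

(** An extended integral with a finite value forces integrability, which is the
    part of [cross_moment] that the equation of matrices does not mention. *)
Lemma cross_moment_expectation_mx a (B : 'M[R]_p) :
    (forall i, measurable_fun [set: T] (fun w => a w i 0)) ->
  cross_moment P a a B <->
  map_mx EFin B = expectation_mx P (fun w => a w *m (a w)^T).
Proof.
move=> ma; split=> [aB|/matrixP aB i j].
  by apply/matrixP => i j; rewrite expectation_mx_outer mxE; have [_ ->] := aB i j.
have := aB i j; rewrite expectation_mx_outer mxE => aBij; split=> //.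
have maa : measurable_fun [set: T] (fun w => a w i 0 * a w j 0).
  exact: measurable_funM.
apply/integrableP; split; first exact/measurable_EFinP.
by rewrite integral_fin_num_abs// -aBij.
Qed.

Lemma sqr_norm2 (v : 'cV[R]_p) : norm2 v ^+ 2 = \sum_i v i 0 ^+ 2.
Proof. by rewrite sqr_sqrtr// sumr_ge0// => i _; exact: sqr_ge0. Qed.

End second_moments.

(** * Efficiency and the trace *)

Theorem theorem2 (R : realType) (n p : nat)
  (d : measure_display) (T : measurableType d)
  (Theta : set 'cV[R]_p) (theta : 'cV[R]_p)
  (P : 'cV[R]_p -> probability T R)
  (X : {mfun T >-> Rn R n})
  (f : Rn R n -> 'cV[R]_p -> R)
  (thetahat : Rn R n -> 'cV[R]_p) :
  open Theta -> Theta theta ->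
  (forall t, Theta t -> has_density (P t) X (fun x => f x t)) ->
  (forall i, measurable_fun [set: Rn R n] (fun x => thetahat x i 0)) ->
  (forall t, Theta t -> unbiased (P t) X thetahat t) ->
  {ae lebesgue_vec n, forall x, forall j : 'I_p,
     derivable (f x) theta (delta_mx j 0)} ->
  fisher_finite (P theta) X f theta ->
  interchange_int_deriv f thetahat theta ->
  efficient (P theta) X f thetahat theta <->
  (\tr (moore_penrose (fisher (P theta) X f theta)))%:E =
    ('E_(P theta)[fun w => (norm2 (thetahat (X w) - theta) ^+ 2)%R])%E.
Proof.
move=> openTheta Theta_theta density mthetahat unb df fisher_fin interchange.
have [sigma [msigma sigmaE es]] := score_version openTheta Theta_theta density
  mthetahat unb interchange df.
have msX i : measurable_fun [set: T] (fun w => sigma (X w) i 0).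
  by apply: (measurableT_comp (msigma i)); exact: measurable_funP.
have meX i : measurable_fun [set: T] (fun w => (thetahat (X w) - theta) i 0).
  rewrite (_ : (fun w => _) = (fun w => thetahat (X w) i 0 - theta i 0)).
    apply: measurable_funB => //.
    by apply: (measurableT_comp (mthetahat i)); exact: measurable_funP.
  by apply/funext => w; rewrite !mxE.
have score_fisher : cross_moment (P theta) (fun w => score f theta (X w))
    (fun w => score f theta (X w)) (fisher (P theta) X f theta).
  move=> i j; split; first exact: fisher_fin.
  by rewrite mxE expectation_mx_outer fineK// integrable_fin_num//; exact: fisher_fin.
have ss : cross_moment (P theta) (fun w => sigma (X w)) (fun w => sigma (X w))
    (fisher (P theta) X f theta).
  apply: cross_moment_ae_eq score_fisher => // i j; exact: measurable_funM.
have [_ BMB _ _] := moore_penroseP (fisher (P theta) X f theta).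
have Bt := tr_moore_penrose
  (tr_fine_expectation_mx_outer (P theta) (fun w => score f theta (X w))).
rewrite /efficient -(cross_moment_expectation_mx (P theta) _ meX).
rewrite (cross_moment_trace_eq meX msX ss es Bt BMB) expectation.unlock.
rewrite (eq_integral _ _ (fun w _ => congr1 EFin
  (sqr_norm2 (thetahat (X w) - theta)))).
by split=> ->.
Qed.
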